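(* Suppose the usual rank invariant of a persistence module $M\colon\mathbb{R}^d\to\mathrm{Vec}_{\mathbf{k}}$ admits a rank decomposition $(\mathcal{R},\mathcal{S})$ over arbitrary rectangles in $\mathbb{R}^d$. Then, for any $\varepsilon\in\mathbb{R}_{\ge0}^d$, the pair $(\mathcal{R}^\varepsilon,\mathcal{S}^\varepsilon)$, where $\mathcal{R}^\varepsilon=\{R^\varepsilon\mid R\in\mathcal{R}\}$ and $\mathcal{S}^\varepsilon=\{S^\varepsilon\mid S\in\mathcal{S}\}$ (as multi-sets), decomposes the usual rank invariant of the $\varepsilon$-smoothing $M^\varepsilon$, i.e. $\operatorname{Rk}M^\varepsilon=\operatorname{Rk}\mathbf{k}_{\mathcal{R}^\varepsilon}-\operatorname{Rk}\mathbf{k}_{\mathcal{S}^\varepsilon}$. When $(\mathcal{R},\mathcal{S})$ is minimal, so is $(\mathcal{R}^\varepsilon,\mathcal{S}^\varepsilon)$ after removing the empty rectangles from $\mathcal{R}^\varepsilon$ and $\mathcal{S}^\varepsilon$.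
   Context: Fix a field $\mathbf{k}$. $\mathbb{R}^d$ carries the product order; a persistence module over $\mathbb{R}^d$ is a functor $M\colon\mathbb{R}^d\to\mathrm{Vec}_{\mathbf{k}}$. The usual rank invariant is $\operatorname{Rk}M(s,t)=\operatorname{rank}[M(s)\to M(t)]$ for $s\le t$. A rectangle is a product of $d$ non-empty intervals of $\mathbb{R}$ (open, closed, half-open, possibly unbounded). For $R\subseteq\mathbb{R}^d$ a rectangle (or empty), $\mathbf{k}_R$ is the module equal to $\mathbf{k}$ on $R$ and $0$ elsewhere with identity maps inside $R$; for a multi-set $\mathcal{R}$, $\mathbf{k}_{\mathcal{R}}=\bigoplus_{R\in\mathcal{R}}\mathbf{k}_R$. A rank decomposition of $\operatorname{Rk}M$ over rectangles is a pair $(\mathcal{R},\mathcal{S})$ of multi-sets of rectangles with $\operatorname{Rk}\mathbf{k}_{\mathcal{R}}$, $\operatorname{Rk}\mathbf{k}_{\mathcal{S}}$ finite-valued and $\operatorname{Rk}M=\operatorname{Rk}\mathbf{k}_{\mathcal{R}}-\operatorname{Rk}\mathbf{k}_{\mathcal{S}}$; it is minimal if $\mathcal{R}$ and $\mathcal{S}$ are disjoint as multi-sets. For $\varepsilon\in\mathbb{R}_{\ge0}^d$, the $\varepsilon$-shift $M[\varepsilon]$ is given by $M[\varepsilon](t)=M(t+\varepsilon)$ and $M[\varepsilon](s\le t)=M(s+\varepsilon\le t+\varepsilon)$; the $\varepsilon$-smoothing $M^\varepsilon$ is the image of the canonical morphism $M\to M[\varepsilon]$ given by the structure maps of $M$.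 For a rectangle $R$, $R^\varepsilon=R\cap(R-\varepsilon)$ where $R-\varepsilon=\{t-\varepsilon\mid t\in R\}$; this is a rectangle or empty. *)

(* Defs.v *)
From HB Require Import structures.
From mathcomp Require Import all_boot all_order all_algebra.
From mathcomp Require Import all_classical all_reals.
From mathcomp Require Import num_normedtype normed_module.

Set Implicit Arguments.
Unset Strict Implicit.
Unset Printing Implicit Defensive.

Import Order.TTheory GRing.Theory Num.Theory.
Local Open Scope classical_set_scope.
Local Open Scope ring_scope.

Record subspace (k : fieldType) (V : lmodType k) := Subspace {
  subspace_set :> V -> Prop;
  subspace0 : subspace_set 0;
  subspaceP : forall (a : k) (u v : V),
    subspace_set u -> subspace_set v -> subspace_set (a *: u + v) }.

Definition subspace_mem (k : fieldType) (V : lmodType k) (W : subspace V) :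
  {pred V} := fun x => `[< W x >].

Lemma subspace_memP (k : fieldType) (V : lmodType k) (W : subspace V) :
  submod_closed (subspace_mem W).
Proof.
split; first by apply/asboolP; exact: subspace0.
by move=> a u v /asboolP Wu /asboolP Wv; apply/asboolP; exact: subspaceP.
Qed.

HB.instance Definition _ (k : fieldType) (V : lmodType k) (W : subspace V) :=
  GRing.isSubmodClosed.Build k V (subspace_mem W) (subspace_memP W).

Definition subspace_type (k : fieldType) (V : lmodType k) (W : subspace V) :=
  {x : V | x \in subspace_mem W}.

Section SubspaceType.
Variables (k : fieldType) (V : lmodType k) (W : subspace V).

HB.instance Definition _ := SubChoice.on (subspace_type W).
HB.instance Definition _ :=
  [SubChoice_isSubLmodule of subspace_type W by <:].

Definition subspace_mk (x : V) (hx : W x) : subspace_type W :=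
  exist _ x (asboolT hx).

Lemma subspace_val (x : subspace_type W) : W (val x).
Proof. exact/asboolP/(valP x). Qed.

End SubspaceType.

Section SubspaceMap.
Variables (k : fieldType) (V V' : lmodType k).
Variables (W : subspace V) (W' : subspace V') (f : {linear V -> V'}).
Hypothesis fW : forall x, W x -> W' (f x).

Definition subspace_fun (x : subspace_type W) : subspace_type W' :=
  subspace_mk (fW (subspace_val x)).

Lemma subspace_fun_linear : linear subspace_fun.
Proof. by move=> a x y; apply: val_inj; rewrite /= !linearP. Qed.

HB.instance Definition _ := GRing.isLinear.Build k _ _ _ subspace_fun
  subspace_fun_linear.

Definition subspace_map : {linear subspace_type W -> subspace_type W'} :=
  subspace_fun.

End SubspaceMap.

Definition dprod (k : fieldType) (I : Type) (V : I -> lmodType k) :=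
  forall i, V i.

Section Dprod.
Variables (k : fieldType) (I : Type) (V : I -> lmodType k).
Local Notation T := (dprod V).

HB.instance Definition _ := gen_eqMixin T.
HB.instance Definition _ := gen_choiceMixin T.

Let add (f g : T) : T := fun i => f i + g i.
Let zero : T := fun=> 0.
Let opp (f : T) : T := fun i => - f i.
Let scale (a : k) (f : T) : T := fun i => a *: f i.

Let addA : associative add.
Proof.
by move=> f g h; apply: functional_extensionality_dep => i;
  exact: addrA.
Qed.
Let addC : commutative add.
Proof.
by move=> f g; apply: functional_extensionality_dep => i;
  exact: addrC.
Qed.
Let add0 : left_id zero add.
Proof.
by move=> f; apply: functional_extensionality_dep => i;
  exact: add0r.
Qed.
Let addN : left_inverse zero opp add.
Proof.
by move=> f; apply: functional_extensionality_dep => i;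
  exact: addNr.
Qed.

HB.instance Definition _ := GRing.isZmodule.Build T addA addC add0 addN.

Let scaleA a b (f : T) : scale a (scale b f) = scale (a * b) f.
Proof. by apply: functional_extensionality_dep => i; exact: scalerA. Qed.
Let scale1 : left_id 1 scale.
Proof.
by move=> f; apply: functional_extensionality_dep => i;
  exact: scale1r.
Qed.
Let scaleDr : right_distributive scale +%R.
Proof.
by move=> a f g; apply: functional_extensionality_dep => i;
  exact: scalerDr.
Qed.
Let scaleDl (f : T) : {morph scale^~ f : a b / a + b}.
Proof.
by move=> a b; apply: functional_extensionality_dep => i;
  exact: scalerDl.
Qed.

HB.instance Definition _ := GRing.Zmodule_isLmodule.Build k T
  scaleA scale1 scaleDr scaleDl.

End Dprod.

Section DprodMap.
Variables (k : fieldType) (I : Type) (V V' : I -> lmodType k).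
Variable f : forall i, {linear V i -> V' i}.

Definition dprod_fun (x : dprod V) : dprod V' := fun i => f i (x i).

Lemma dprod_fun_linear : linear dprod_fun.
Proof.
by move=> a x y; apply: functional_extensionality_dep => i;
  exact: linearP.
Qed.

HB.instance Definition _ := GRing.isLinear.Build k _ _ _ dprod_fun
  dprod_fun_linear.

Definition dprod_map : {linear dprod V -> dprod V'} := dprod_fun.

End DprodMap.

Definition is_basis (k : fieldType) (V : lmodType k) (A : set V) (n : nat)
    (v : 'I_n -> V) : Prop :=
  (forall c : 'I_n -> k, \sum_i c i *: v i = 0 -> forall i, c i = 0) /\
  A = [set x | exists c : 'I_n -> k, x = \sum_i c i *: v i].

(* All infinite dimensions are identified with +oo. *)
Definition dimension (k : fieldType) (V : lmodType k) (A : set V) : \bar int :=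
  match pselect (exists n, exists v : 'I_n -> V, is_basis A v) with
  | left h => ((projT1 (cid h))%:Z)%:E
  | right _ => +oo%E
  end.

Definition rank (k : fieldType) (U V : lmodType k) (f : {linear U -> V}) :
  \bar int := dimension (range f).

Definition lev (R : realType) (d : nat) (s t : 'rV[R]_d) : bool :=
  [forall i, s 0 i <= t 0 i].

Notation "s <=v t" := (lev s t) (at level 70, no associativity).

Lemma lev_add (R : realType) (d : nat) (e s t : 'rV[R]_d) :
  s <=v t -> s + e <=v t + e.
Proof. by move=> /forallP h; apply/forallP => i; rewrite !mxE lerD2r. Qed.

Lemma lev_addr (R : realType) (d : nat) (e t : 'rV[R]_d) :
  0 <=v e -> t <=v t + e.
Proof.
by move=> /forallP h; apply/forallP => i; move: (h i); rewrite !mxE lerDl.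
Qed.

Lemma lev_trans (R : realType) (d : nat) (t s u : 'rV[R]_d) :
  s <=v t -> t <=v u -> s <=v u.
Proof.
by move=> /forallP h /forallP h'; apply/forallP => i; exact: le_trans (h' i).
Qed.

Record persmod (k : fieldType) (R : realType) (d : nat) := PersMod {
  pm_space :> 'rV[R]_d -> lmodType k;
  pm_map : forall s t, s <=v t -> {linear pm_space s -> pm_space t};
  pm_id : forall t (h : t <=v t) x, pm_map h x = x;
  pm_comp : forall s t u (hst : s <=v t) (htu : t <=v u) (hsu : s <=v u) x,
    pm_map htu (pm_map hst x) = pm_map hsu x }.

Arguments pm_map {k R d} p {s t}.

Definition Rk (k : fieldType) (R : realType) (d : nat) (M : persmod k R d)
  (s t : 'rV[R]_d) (h : s <=v t) : \bar int := rank (pm_map M h).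

Arguments Rk {k R d} M {s t}.

Record persmor (k : fieldType) (R : realType) (d : nat) (M N : persmod k R d) :=
  PersMor {
    pmor :> forall t, {linear M t -> N t};
    pmor_nat : forall s t (h : s <=v t) x,
      pmor t (pm_map M h x) = pm_map N h (pmor s x) }.

Section Image.
Variables (k : fieldType) (R : realType) (d : nat) (M N : persmod k R d).
Variable f : persmor M N.

Lemma image_subproof t (a : k) (u v : N t) :
  range (f t) u -> range (f t) v -> range (f t) (a *: u + v).
Proof.
by move=> [x _ <-] [y _ <-]; exists (a *: x + y) => //; rewrite linearP.
Qed.

Definition image_subspace t : subspace (N t) :=
  @Subspace k (N t) (range (f t)) (ex_intro2 _ _ 0 I (linear0 (f t)))
    (@image_subproof t).

Lemma image_map_subproof s t (h : s <=v t) x :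
  image_subspace s x -> image_subspace t (pm_map N h x).
Proof. by move=> [y _ <-]; exists (pm_map M h y); rewrite ?pmor_nat. Qed.

Definition image_module : persmod k R d.
Proof.
refine (@PersMod k R d (fun t => subspace_type (image_subspace t))
  (fun s t h => subspace_map (@image_map_subproof s t h)) _ _).
- by move=> t h x; apply: val_inj; rewrite /= pm_id.
- by move=> s t u hst htu hsu x; apply: val_inj; rewrite /= (pm_comp _ _ hsu).
Defined.

End Image.

Section Smoothing.
Variables (k : fieldType) (R : realType) (d : nat) (M : persmod k R d).
Variable e : 'rV[R]_d.

Definition shift_module : persmod k R d.
Proof.
refine (@PersMod k R d (fun t => M (t + e))
  (fun s t h => pm_map M (lev_add e h)) _ _).
- by move=> t h x; exact: pm_id.
- by move=> s t u hst htu hsu x; exact: pm_comp.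
Defined.

Definition shift_mor (he : 0 <=v e) : persmor M shift_module.
Proof.
refine (@PersMor k R d M shift_module (fun t => pm_map M (lev_addr t he)) _).
move=> s t h x /=.
have hse : s <=v t + e by exact: lev_trans (lev_addr t he).
by rewrite !(pm_comp _ _ hse).
Defined.

Definition smoothing (he : 0 <=v e) : persmod k R d :=
  image_module (shift_mor he).

End Smoothing.

Section DirectSum.
Variables (k : fieldType) (R : realType) (d : nat).
Variables (I : Type) (F : I -> persmod k R d).

Definition finite_support t (x : dprod (fun i => F i t)) : Prop :=
  finite_set [set i | x i <> 0].

Lemma dsum_subproof0 t : @finite_support t 0.
Proof.
rewrite /finite_support (_ : mkset _ = set0) //.
by apply/seteqP; split => // i /=.
Qed.

Lemma dsum_subproof t (a : k) (u v : dprod (fun i => F i t)) :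
  finite_support u -> finite_support v -> finite_support (a *: u + v).
Proof.
move=> fu fv; apply: (@sub_finite_set _ _
  ([set i | u i <> 0] `|` [set i | v i <> 0])).
  move=> i /= h; have [ui|ui] := pselect (u i = 0); last by left.
  right => vi; apply: h; rewrite (_ : (a *: u + v) i = a *: u i + v i) //.
  by rewrite ui vi scaler0 addr0.
by rewrite finite_setU.
Qed.

Definition dsum_subspace t : subspace (dprod (fun i => F i t)) :=
  Subspace (@dsum_subproof0 t) (@dsum_subproof t).

Lemma dsum_map_subproof s t (h : s <=v t) x : dsum_subspace s x ->
  dsum_subspace t (dprod_map (fun i => pm_map (F i) h) x).
Proof.
by apply: sub_finite_set => i /= h1 h2; apply: h1;
  rewrite /dprod_fun h2 linear0.
Qed.

Definition dsum : persmod k R d.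
Proof.
refine (@PersMod k R d (fun t => subspace_type (dsum_subspace t))
  (fun s t h => subspace_map (@dsum_map_subproof s t h)) _ _).
- move=> t h x; apply: val_inj; apply: functional_extensionality_dep => i.
  exact: pm_id.
- move=> s t u hst htu hsu x; apply: val_inj.
  by apply: functional_extensionality_dep => i; exact: pm_comp.
Defined.

End DirectSum.

Definition is_rectangle (R : realType) (d : nat) (A : set 'rV[R]_d) : Prop :=
  exists I : 'I_d -> interval R,
    (forall i, [set` I i] !=set0) /\
    A = [set x | forall i, x 0 i \in I i].

(* Rectangles and the empty set. *)
Record rectangle0 (R : realType) (d : nat) := Rectangle0 {
  rect_set : set 'rV[R]_d;
  rect_setP : is_rectangle rect_set \/ rect_set = set0 }.

Lemma rectangle0_convex (R : realType) (d : nat) (A : rectangle0 R d)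
  (s t u : 'rV[R]_d) : s <=v t -> t <=v u ->
  rect_set A s -> rect_set A u -> rect_set A t.
Proof.
move=> /forallP hst /forallP htu; case: A => A /= [|->//].
move=> [I [_ ->]] /= hs hu i.
by apply: (@interval_is_interval _ (I i) (s 0 i) (u 0 i));
  rewrite /= ?hs ?hu ?hst ?htu.
Qed.

Definition smooth_set (R : realType) (d : nat) (e : 'rV[R]_d)
  (A : set 'rV[R]_d) : set 'rV[R]_d := A `&` [set t - e | t in A].

Lemma smooth_setP (R : realType) (d : nat) (e : 'rV[R]_d) (A : rectangle0 R d) :
  is_rectangle (smooth_set e (rect_set A)) \/
  smooth_set e (rect_set A) = set0.
Proof.
have [->|/set0P[x0 Ax0]] := eqVneq (smooth_set e (rect_set A)) set0;
  [by right|left].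
case: A Ax0 => A /= [|->]; last by move=> [].
move=> [I [_ ->]] Ax0.
pose J i : set R := [set y | y \in I i /\ y + e 0 i \in I i].
have itvJ i : is_interval (J i).
  move=> x y [hx hx'] [hy hy'] z /andP[xz zy]; split.
    by apply: (@interval_is_interval _ (I i) x y); rewrite /= ?hx ?hy ?xz ?zy.
  by apply: (@interval_is_interval _ (I i) (x + e 0 i) (y + e 0 i));
    rewrite /= ?hx' ?hy' ?lerD2r ?xz ?zy.
have SE : smooth_set e [set x | forall i, x 0 i \in I i] =
    [set x | forall i, J i (x 0 i)].
  apply/seteqP; split => [x [/= hx [y hy yx]] i|x hx].
    by split; [exact: hx|rewrite -yx !mxE subrK].
  split => /= [i|]; first by case: (hx i).
  exists (x + e); last by rewrite addrK.
  by move=> i /=; rewrite mxE; case: (hx i).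
exists (fun i => Rhull (J i)); split => [i|].
  have /is_intervalP <- := itvJ i.
  by exists (x0 0 i); move: Ax0; rewrite SE; apply.
rewrite SE; apply/seteqP; split => x hx i; have := hx i.
  by have /is_intervalP {1}-> := itvJ i.
by move=> h; have /is_intervalP -> := itvJ i.
Qed.

Definition smooth_rect (R : realType) (d : nat) (e : 'rV[R]_d)
  (A : rectangle0 R d) : rectangle0 R d := Rectangle0 (smooth_setP e A).

Section RectModule.
Variables (k : fieldType) (R : realType) (d : nat) (A : rectangle0 R d).

(* k_A(t) is the subspace k of k if A contains t, and the subspace 0 if not.
   The structure map from s to t is the multiplication by 1 if A contains t,
   and by 0 if not. *)
Definition rect_subspace (t : 'rV[R]_d) : subspace k^o.
Proof.
refine (@Subspace k k^o (fun x => ~ rect_set A t -> x = 0) _ _) => //.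
by move=> a u v /= hu hv h; rewrite hu// hv// scaler0 addr0.
Defined.

Lemma rect_map_subproof (s t : 'rV[R]_d) (x : k^o) :
  rect_subspace s x -> rect_subspace t (((t \in rect_set A)%:R : k) *: x).
Proof. by move=> _ /= h; rewrite memNset// scale0r. Qed.

Definition rect_module : persmod k R d.
Proof.
refine (@PersMod k R d (fun t => subspace_type (rect_subspace t))
  (fun s t h => @subspace_map k k^o k^o _ _
     [the {linear k^o -> k^o} of *:%R ((t \in rect_set A)%:R : k)]
     (@rect_map_subproof s t)) _ _).
- move=> t h x; apply: val_inj => /=.
  have [At|At] := pselect (rect_set A t).
    by rewrite mem_set// scale1r.
  by rewrite (subspace_val x At) scaler0.
- move=> s t u hst htu hsu x; apply: val_inj; rewrite /= scalerA.
  have [As|As] := pselect (rect_set A s); last first.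
    by rewrite (subspace_val x As) !scaler0.
  have [Au|Au] := pselect (rect_set A u); last first.
    by rewrite (memNset Au) !scale0r mul0r scale0r.
  have At := rectangle0_convex hst htu As Au.
  by rewrite !mem_set// mulr1.
Defined.

End RectModule.

(* A multi-set, possibly infinite, is given by a family of elements: the
   multiplicity of x is the number of indices mapped to x. *)
Record multiset (T : Type) := Multiset {
  ms_idx : Type;
  ms_elt :> ms_idx -> T }.

Definition ms_mem (T : Type) (X : multiset T) (x : T) : Prop :=
  exists i, X i = x.

Definition ms_map (T U : Type) (f : T -> U) (X : multiset T) : multiset U :=
  @Multiset U (ms_idx X) (fun i => f (X i)).

Definition ms_filter (T : Type) (P : T -> Prop) (X : multiset T) :
  multiset T := @Multiset T {i : ms_idx X | P (X i)} (fun i => X (sval i)).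

Definition ms_disjoint (T : Type) (X Y : multiset T) : Prop :=
  forall x, ~ (ms_mem X x /\ ms_mem Y x).

Definition rects_module (k : fieldType) (R : realType) (d : nat)
  (X : multiset (rectangle0 R d)) : persmod k R d :=
  dsum (fun i => rect_module k (X i)).

Definition decomposes_rank (k : fieldType) (R : realType) (d : nat)
    (M : persmod k R d) (X Y : multiset (rectangle0 R d)) : Prop :=
  forall (s t : 'rV[R]_d) (h : s <=v t),
    [/\ Rk (rects_module k X) h \is a fin_num,
        Rk (rects_module k Y) h \is a fin_num &
        (Rk M h = Rk (rects_module k X) h - Rk (rects_module k Y) h)%E].

Definition rank_decomposition (k : fieldType) (R : realType) (d : nat)
    (M : persmod k R d) (X Y : multiset (rectangle0 R d)) : Prop :=
  [/\ forall A, ms_mem X A -> is_rectangle (rect_set A),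
      forall A, ms_mem Y A -> is_rectangle (rect_set A) &
      decomposes_rank M X Y].

Definition minimal_rank_decomposition (k : fieldType) (R : realType) (d : nat)
    (M : persmod k R d) (X Y : multiset (rectangle0 R d)) : Prop :=
  rank_decomposition M X Y /\ ms_disjoint X Y.

Definition smooth_ms (R : realType) (d : nat) (e : 'rV[R]_d)
  (X : multiset (rectangle0 R d)) : multiset (rectangle0 R d) :=
  ms_map (smooth_rect e) X.

Definition nonempty_ms (R : realType) (d : nat)
  (X : multiset (rectangle0 R d)) : multiset (rectangle0 R d) :=
  ms_filter (fun A => rect_set A !=set0) X.

(* Main.v *)
Require Import Defs.
From mathcomp Require Import all_boot all_order all_algebra.
From mathcomp Require Import all_classical all_reals.
From mathcomp Require Import num_normedtype.

Import GRing.Theory.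
Local Open Scope ring_scope.

(** Both ranks reduce to ranks of the original modules: the range of
    M^e(s) -> M^e(t) is that of M(s) -> M(t + e), and by convexity s and t both
    lie in R^e iff s and t + e both lie in R. Minimality is preserved because a
    rectangle R is recovered from a non-empty R^e as the set of the x with
    y <= x <= z + e for some y, z in R^e. *)

Import Order.TTheory Num.Theory.

Set Implicit Arguments.
Unset Strict Implicit.

Local Open Scope classical_set_scope.

(** * Dimension of isomorphic subspaces *)

(** Images [w i] of the basis vectors are chosen along [r]. By linearity, [r] relates combinations
    with the same coefficients, so [r_inj] gives freeness of [w] and [r_fun] gives that it spans
    [B]. *)
Lemma is_basis_transfer (k : fieldType) (V W : lmodType k) (A : set V)
    (B : set W) (r : V -> W -> Prop)
    (r0 : r 0 0)
    (rlin : forall (a : k) u v u' v',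
      r u u' -> r v v' -> r (a *: u + v) (a *: u' + v'))
    (r_inj : forall v, r v 0 -> v = 0) (r_fun : forall w, r 0 w -> w = 0)
    (AB : forall v, A v -> exists2 w, B w & r v w)
    (BA : forall w, B w -> exists2 v, A v & r v w)
    (n : nat) (v : 'I_n -> V) :
  is_basis A v -> exists w : 'I_n -> W, is_basis B w.
Proof.
move=> [free_v spanA].
have Av i : A (v i).
  rewrite spanA; exists (fun j => (j == i)%:R).
  rewrite (bigD1 i)//= eqxx scale1r big1 ?addr0// => j /negbTE ->.
  by rewrite scale0r.
have [w Bw] : exists w : 'I_n -> W, forall i, B (w i) /\ r (v i) (w i).
  suff /choice[w wP] : forall i, exists w, B w /\ r (v i) w by exists w.
  by move=> i; have [x Bx rx] := AB _ (Av i); exists x.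
have rsum (c : 'I_n -> k) : r (\sum_i c i *: v i) (\sum_i c i *: w i).
  apply: (big_ind2 r) => //.
    by move=> x x' y y' rx ry; have := rlin 1 _ _ _ _ rx ry; rewrite !scale1r.
  move=> i _; have := rlin (c i) _ _ _ _ (Bw i).2 r0.
  by rewrite !addr0.
have r_eq x y y' : r x y -> r x y' -> y = y'.
  move=> rx rx'; apply/subr0_eq/r_fun.
  by have := rlin (-1) _ _ _ _ rx' rx; rewrite !scaleN1r addrC subrr addrC.
exists w; split.
  by move=> c c0; apply: free_v; apply: r_inj; rewrite -c0.
apply/seteqP; split => x /=.
  move=> /BA[y]; rewrite spanA => -[c ->] ryx; exists c.
  exact: r_eq ryx (rsum c).
move=> [c ->].
have [|y By ry] := AB (\sum_i c i *: v i); first by rewrite spanA; exists c.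
by rewrite (r_eq _ _ _ (rsum c) ry).
Qed.

(** The size chosen by [dimension] depends only on the predicate of being the size of a basis, and
    equivalent predicates are equal by extensionality. *)
Lemma eq_dimension (k : fieldType) (V W : lmodType k) (A : set V) (B : set W) :
  (forall n, (exists v : 'I_n -> V, is_basis A v) <->
             (exists w : 'I_n -> W, is_basis B w)) ->
  dimension A = dimension B.
Proof.
move=> AB.
pose dim (Q : nat -> Prop) : \bar int :=
  match pselect (exists n, Q n) with
  | left h => ((projT1 (cid h))%:Z)%:E
  | right _ => +oo%E
  end.
rewrite -[LHS]/(dim (fun n => exists v : 'I_n -> V, is_basis A v)).
rewrite -[RHS]/(dim (fun n => exists w : 'I_n -> W, is_basis B w)).
by congr dim; apply/funext => n; apply/propext.
Qed.

(* The linear isomorphism of [A] with [B] is given by its graph [r]. *)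
Lemma dimension_iso (k : fieldType) (V W : lmodType k) (A : set V) (B : set W)
    (r : V -> W -> Prop)
    (r0 : r 0 0)
    (rlin : forall (a : k) u v u' v',
      r u u' -> r v v' -> r (a *: u + v) (a *: u' + v'))
    (r_inj : forall v, r v 0 -> v = 0) (r_fun : forall w, r 0 w -> w = 0)
    (AB : forall v, A v -> exists2 w, B w & r v w)
    (BA : forall w, B w -> exists2 v, A v & r v w) :
  dimension A = dimension B.
Proof.
apply: eq_dimension => n; split => -[v].
  exact: (is_basis_transfer r0 rlin r_inj r_fun AB BA).
apply: (is_basis_transfer (r := fun w v => r v w)) => //.
by move=> a x y x' y' rx ry; exact: rlin.
Qed.

(** * Rank of the smoothing *)

(** The inclusion [val] of M^e(t) in M(t + e) identifies the two ranges: every vector of M^e(s)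
    comes from some [y] in M(s), and its image is that of [y] along s <= s + e <= t + e. *)
Lemma Rk_smoothing (k : fieldType) (R : realType) (d : nat)
    (M : persmod k R d) (e : 'rV[R]_d) (he : 0 <=v e) (s t : 'rV[R]_d)
    (h : s <=v t) (h' : s <=v t + e) :
  Rk (smoothing M he) h = Rk M h'.
Proof.
apply: (dimension_iso (r := fun v w => val v = w)) => //.
- by move=> a u v _ _ <- <-; rewrite linearP.
- by move=> v v0; apply: val_inj.
- move=> _ [x _ <-]; have [y _ yx] := subspace_val x.
  exists (pm_map M h' y); first by exists y.
  by rewrite /= -yx/= (pm_comp _ _ h').
- move=> _ [y _ <-].
  pose x : smoothing M he s := @subspace_mk k _
    (image_subspace (shift_mor M he) s) _ (ex_intro2 _ _ y I erefl).
  exists (pm_map (smoothing M he) h x); first by exists x.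
  by rewrite /= (pm_comp _ _ h').
Qed.

(** * Ranks of direct sums of rectangle modules *)

Section RectsModule.
Variables (k : fieldType) (R : realType) (d : nat).
Implicit Type X : multiset (rectangle0 R d).

(** Turns a vector into a finitely supported function from indices to [k], free of the nested
    subspace types. *)
Definition rects_coef {X} {t : 'rV[R]_d} (x : rects_module k X t)
  (i : ms_idx X) : k := val (val x i).

Lemma rects_coef_inj X t : injective (@rects_coef X t).
Proof.
move=> x y xy; apply: val_inj; apply: functional_extensionality_dep => i.
by apply: val_inj; have := congr1 (fun f => f i) xy.
Qed.

Lemma rects_coefP X t (a : k) (x y : rects_module k X t) i :
  rects_coef (a *: x + y) i = a * rects_coef x i + rects_coef y i.
Proof. by []. Qed.

Lemma rects_coef_finite X t (x : rects_module k X t) :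
  finite_set [set i | rects_coef x i != 0].
Proof.
have := subspace_val x; apply: sub_finite_set => i /= /eqP xi0 xi.
by apply: xi0; exact: (congr1 val xi).
Qed.

Lemma rects_coef_surj X t (c : ms_idx X -> k) :
  finite_set [set i | c i != 0] ->
  (forall i, c i != 0 -> rect_set (X i) t) ->
  exists x : rects_module k X t, rects_coef x = c.
Proof.
move=> cfin cX.
have cP i : rect_subspace k (X i) t (c i).
  move=> /= Xit; have [//|/cX] := eqVneq (c i) 0.
  by move=> /Xit.
pose x : dprod (fun i => rect_module k (X i) t) := fun i => subspace_mk (cP i).
have xP : dsum_subspace (fun i => rect_module k (X i)) t x.
  apply: sub_finite_set cfin => i /= xi0; apply/eqP => ci0.
  by apply: xi0; apply: val_inj.
by exists (subspace_mk xP).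
Qed.

Lemma rects_coef_map X s t (h : s <=v t) (x : rects_module k X s) i :
  rects_coef (pm_map (rects_module k X) h x) i =
  (t \in rect_set (X i))%:R * rects_coef x i.
Proof. by []. Qed.

Lemma rects_rangeP X s t (h : s <=v t) (y : rects_module k X t) :
  range (pm_map (rects_module k X) h) y <->
  forall i, rects_coef y i != 0 -> rect_set (X i) s /\ rect_set (X i) t.
Proof.
split=> [[x _ <-] i|yX].
  rewrite rects_coef_map mulf_eq0 negb_or => /andP[Xit xi0]; split.
    apply: contrapT => Xis; move: xi0.
    by rewrite /rects_coef (subspace_val (val x i) Xis) eqxx.
  by apply: contrapT => Xit'; rewrite memNset// eqxx in Xit.
(* The preimage has the same coefficients as [y]: the structure map multiplies each of them by 1. *)
have [i /yX[]//|x xy] := rects_coef_surj (t := s) (rects_coef_finite y).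
exists x => //; apply: rects_coef_inj; apply/funext => i.
rewrite rects_coef_map xy.
have [->|/yX[_ Xit]] := eqVneq (rects_coef y i) 0; first by rewrite mulr0.
by rewrite mem_set// mul1r.
Qed.

(** By [rects_rangeP], each range consists of the finitely supported functions on the indices of
    rectangles containing both points, and [f] is a bijection between these index sets. *)
Lemma Rk_rects_reindex X Y (f : ms_idx Y -> ms_idx X) (s t s' t' : 'rV[R]_d)
    (h : s <=v t) (h' : s' <=v t') :
  injective f ->
  (forall j, rect_set (X (f j)) s /\ rect_set (X (f j)) t <->
             rect_set (Y j) s' /\ rect_set (Y j) t') ->
  (forall i, rect_set (X i) s -> rect_set (X i) t -> range f i) ->
  Rk (rects_module k X) h = Rk (rects_module k Y) h'.
Proof.
move=> f_inj XY Xf.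
(* [u] is the extension by zero of [v] along [f]. *)
pose r (u : rects_module k X t) (v : rects_module k Y t') :=
  (forall j, rects_coef u (f j) = rects_coef v j) /\
  (forall i, ~ range f i -> rects_coef u i = 0).
apply: (dimension_iso (r := r)).
- by [].
- move=> a u v u' v' [u1 u2] [v1 v2]; split=> [j|i fi].
    by rewrite !rects_coefP u1 v1.
  by rewrite rects_coefP u2// v2// mulr0 addr0.
- move=> u [u1 u2]; apply: rects_coef_inj; apply/funext => i.
  have [[j _ <-]|/u2->//] := pselect (range f i).
  by rewrite u1.
- move=> v [v1 _]; apply: rects_coef_inj; apply/funext => j.
  by rewrite -v1.
- move=> u /rects_rangeP uX.
  have [| |v vu] := @rects_coef_surj Y t' (rects_coef u \o f).
  + apply: (@finite_preimage _ _ [set i | rects_coef u i != 0] f).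
      by move=> ? ? _ _; exact: f_inj.
    exact: rects_coef_finite.
  + by move=> j /uX/XY[].
  exists v.
    by apply/rects_rangeP => j; rewrite vu => /uX/XY.
  split=> [j|i fi]; first by rewrite vu.
  by have [//|/uX[Xs Xt]] := eqVneq (rects_coef u i) 0; case: fi; exact: Xf.
- move=> v /rects_rangeP vY.
  (* The extension by zero of [v]; injectivity of [f] determines the chosen preimage. *)
  pose c i : k := if pselect (range f i) is left fi
    then rects_coef v (projT1 (cid2 fi)) else 0.
  have cf j : c (f j) = rects_coef v j.
    rewrite /c; case: pselect => [fj|[]]; last by exists j.
    by case: cid2 => j' _ /= /f_inj ->.
  have cN i : ~ range f i -> c i = 0 by rewrite /c; case: pselect.
  have c_range i : c i != 0 -> exists2 j, f j = i & rects_coef v j != 0.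
    have [[j _ <-]|/cN->] := pselect (range f i); last by rewrite eqxx.
    by rewrite cf; exists j.
  have [| |u uc] := @rects_coef_surj X t c.
  + apply: sub_finite_set (finite_image f (rects_coef_finite v)).
    by move=> i /c_range[j <- vj]; exists j.
  + by move=> i /c_range[j <- /vY/XY[]].
  exists u; last by split=> [j|i]; rewrite uc; [exact: cf|exact: cN].
  by apply/rects_rangeP => i; rewrite uc => /c_range[j <- /vY/XY].
Qed.

End RectsModule.

(** * Smoothing of rectangles *)

Lemma smooth_setE (R : realType) (d : nat) (e : 'rV[R]_d)
    (A : set 'rV[R]_d) :
  smooth_set e A = [set x | A x /\ A (x + e)].
Proof.
apply/seteqP; split=> x /= [Ax]; last first.
  by move=> Axe; split=> //; exists (x + e); rewrite ?addrK.
by move=> [y Ay yx]; split=> //; rewrite -yx subrK.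
Qed.

Lemma smooth_rect_pair (R : realType) (d : nat) (e : 'rV[R]_d) (he : 0 <=v e)
    (A : rectangle0 R d) (s t : 'rV[R]_d) (h : s <=v t) :
  rect_set A s /\ rect_set A (t + e) <->
  rect_set (smooth_rect e A) s /\ rect_set (smooth_rect e A) t.
Proof.
rewrite /= smooth_setE; split=> [[As At]|[[As _] [_ At]]] //.
split; split=> //.
  (* Both s + e and t lie between s and t + e. *)
  exact: rectangle0_convex (lev_addr s he) (lev_add e h) As At.
exact: rectangle0_convex h (lev_addr t he) As At.
Qed.

Lemma smooth_rect_hull (R : realType) (d : nat) (e : 'rV[R]_d) (he : 0 <=v e)
    (A : rectangle0 R d) :
  rect_set (smooth_rect e A) !=set0 ->
  rect_set A = [set x | exists y z, [/\ rect_set (smooth_rect e A) y,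
    rect_set (smooth_rect e A) z, y <=v x & x <=v z + e]].
Proof.
rewrite /= smooth_setE => -[w [Aw Awe]]; apply/seteqP; split => x; last first.
  move=> [y [z [[Ay _] [_ Az] yx xz]]].
  exact: rectangle0_convex yx xz Ay Az.
case: (A) Aw Awe => B /= [|->//] [I [_ ->]] /= Iw Iwe Ix.
have e_ge0 i : 0 <= e 0 i by have /forallP/(_ i) := he; rewrite mxE.
have Iconv i a b c : a \in I i -> b \in I i -> a <= c -> c <= b -> c \in I i.
  move=> Ia Ib ac cb; apply: (@interval_is_interval _ (I i) a b) => //=.
  by rewrite ac.
have {}Iwe i : w 0 i + e 0 i \in I i by have := Iwe i; rewrite mxE.
(* With [w] in A^e, the point min(x, w) stays in A^e: where x < w, x + e lies between x and w + e.
   Dually for max(x - e, w): where x - e > w, x - e lies between w and x. *)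
exists (\row_i Num.min (x 0 i) (w 0 i)).
exists (\row_i Num.max (x 0 i - e 0 i) (w 0 i)); split.
- split=> i; rewrite !mxE; case: leP => // xw.
  by apply: Iconv (Ix i) (Iwe i) _ _; rewrite ?lerDl ?lerD2r.
- split=> i; rewrite !mxE; case: leP => // xw.
    by apply: Iconv (Iw i) (Ix i) (ltW xw) _; rewrite gerBl.
  by rewrite subrK.
- by apply/forallP => i; rewrite !mxE ge_min lexx.
- by apply/forallP => i; rewrite !mxE -lerBlDr le_max lexx.
Qed.

Lemma rect_set_inj (R : realType) (d : nat) : injective (@rect_set R d).
Proof.
move=> [A hA] [B hB] /= AB; case: _ / AB hB => hB.
by congr Rectangle0; exact: Prop_irrelevance.
Qed.

(** The set in [smooth_rect_hull] depends on [A] only through A^e. *)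
Lemma smooth_rect_inj (R : realType) (d : nat) (e : 'rV[R]_d) (he : 0 <=v e)
    (A B : rectangle0 R d) :
  rect_set (smooth_rect e A) !=set0 ->
  smooth_rect e A = smooth_rect e B -> A = B.
Proof.
move=> A0 AB; apply: rect_set_inj.
by rewrite (smooth_rect_hull he A0) AB -smooth_rect_hull// -AB.
Qed.

(** * Smoothed multi-sets and removal of empty rectangles *)

Lemma Rk_smooth_ms (k : fieldType) (R : realType) (d : nat)
    (X : multiset (rectangle0 R d)) (e : 'rV[R]_d) (he : 0 <=v e)
    (s t : 'rV[R]_d) (h : s <=v t) (h' : s <=v t + e) :
  Rk (rects_module k (smooth_ms e X)) h = Rk (rects_module k X) h'.
Proof.
apply/esym/(@Rk_rects_reindex _ _ _ X (smooth_ms e X) id) => //.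
  by move=> i; exact: smooth_rect_pair.
Qed.

Lemma Rk_nonempty_ms (k : fieldType) (R : realType) (d : nat)
    (X : multiset (rectangle0 R d)) (s t : 'rV[R]_d) (h : s <=v t) :
  Rk (rects_module k (nonempty_ms X)) h = Rk (rects_module k X) h.
Proof.
apply/esym/(@Rk_rects_reindex _ _ _ X (nonempty_ms X) sval) => //.
  by move=> [i hi] [j hj] /= ij; exact: eq_exist.
(* A rectangle containing [s] is non-empty, so its index survives the filter. *)
by move=> i Xis _; exists (exist _ i (ex_intro _ s Xis)).
Qed.

Lemma nonempty_ms_rectangle (R : realType) (d : nat)
    (X : multiset (rectangle0 R d)) (A : rectangle0 R d) :
  ms_mem (nonempty_ms X) A -> is_rectangle (rect_set A).
Proof.
move=> [[i Xi0] <-]; have [//|Xi] := rect_setP (X i).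
by move: Xi0; rewrite Xi => -[].
Qed.

Unset Implicit Arguments.

Theorem lemma6p4 (k : fieldType) (R : realType) (d : nat)
    (M : persmod k R d) (X Y : multiset (rectangle0 R d))
    (decM : rank_decomposition M X Y)
    (e : 'rV[R]_d) (he : 0 <=v e) :
  decomposes_rank (smoothing M he) (smooth_ms e X) (smooth_ms e Y) /\
  (minimal_rank_decomposition M X Y ->
   minimal_rank_decomposition (smoothing M he)
     (nonempty_ms (smooth_ms e X)) (nonempty_ms (smooth_ms e Y))).
Proof.
have dec : decomposes_rank (smoothing M he) (smooth_ms e X) (smooth_ms e Y).
  (* All three ranks at (s, t) become ranks at (s, t + e), where [decM] applies. *)
  move=> s t h; have h' := lev_trans h (lev_addr t he).
  rewrite (Rk_smoothing M he h h') !(Rk_smooth_ms k _ he h h').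
  by case: decM => _ _; apply.
split=> // -[_ disjXY]; split.
  split=> [A|A|s t h]; [exact: nonempty_ms_rectangle..|].
  by rewrite !Rk_nonempty_ms; exact: dec.
move=> _ [[[i Xi0] <-] [[j Yj0] /= YX]].
(* A common non-empty smoothed rectangle comes from a single rectangle, which would then lie in both
   [X] and [Y]. *)
apply: (disjXY (X i)); split; first by exists i.
by exists j; exact: (smooth_rect_inj he Yj0 YX).
Qed.
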